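(* Let $n\ge 1$ and $d\ge 1$ be integers, and let $\phi$ be the polynomial in the coefficients of $f\in\mathbb{R}[x]_{=d}$ described in the context. If $f\in\mathbb{R}[x]_{=d}$ satisfies $\phi(f)\neq 0$, then every SONC point of the problem $\min\{f(x): x\in\mathbb{S}^{n-1}\}$ satisfies the SOSC (i.e., is an SOSC point). Moreover, when $f$ is generic in $\mathbb{R}[x]_{=d}$, every SONC point of the problem $\min\{f(x): x\in\mathbb{S}^{n-1}\}$ is an SOSC point.
   Context: $\mathbb{R}[x]_{=d}$ denotes the real vector space of all homogeneous polynomials of degree $d$ in $x=(x_1,\dots,x_n)$ with real coefficients (including $0$), identified with the space of coefficient vectors. $\mathbb{S}^{n-1}=\{x\in\mathbb{R}^n: x_1^2+\cdots+x_n^2=1\}$. For $x\in\mathbb{S}^{n-1}$, $x^{\perp}:=\{u\in\mathbb{S}^{n-1}: u^Tx=0\}$. Optimality conditions for $\min\{f(x):x\in\mathbb{S}^{n-1}\}$ at a point $x^*\in\mathbb{S}^{n-1}$: - FONC: there exists $\lambda^*\in\mathbb{R}$ with $\nabla f(x^* )-\lambda^*x^*=0$ (such $\lambda^*$ is unique). - SONC (with this $\lambda^*$): $u^T\nabla^2 f(x^* )u-\lambda^*\ge 0$ for all $u\in(x^* )^{\perp}$. - SOSC (with this $\lambda^*$): $u^T\nabla^2 f(x^* )u-\lambda^*> 0$ for all $u\in(x^* )^{\perp}$. A point $x^*\in\mathbb{S}^{n-1}$ is an SONC (resp. SOSC) point if it satisfies the FONC and the SONC (resp. the FONC and the SOSC).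 The polynomial $\phi$: for fixed $n,d$, elimination theory gives finitely many polynomials $\phi_1,\dots,\phi_s$ with integer coefficients, homogeneous in the coefficients of $f$, such that for every $f\in\mathbb{R}[x]_{=d}$ one has $\phi_1(f)=\cdots=\phi_s(f)=0$ if and only if there exist $0\ne x\in\mathbb{C}^n$ and $0\neq y\in\mathbb{C}^n$ with $$\operatorname{rank}\begin{bmatrix}\nabla f(x)& x& 0\\ \nabla^2 f(x)y& y& x\end{bmatrix}\le 2,\qquad y^Tx=0$$ (a $2n\times 3$ matrix; $y^Tx=\sum_i y_ix_i$ with no complex conjugation). Fix such polynomials and set $\phi(f):=\phi_1(f)^2+\cdots+\phi_s(f)^2$. A property holds ''when $f$ is generic in $\mathbb{R}[x]_{=d}$'' if it holds for all $f\in\mathbb{R}[x]_{=d}$ outside a set of Lebesgue measure zero in $\mathbb{R}[x]_{=d}$. *)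

(* Defs.v *)
From HB Require Import structures.
From mathcomp Require Import all_boot all_order all_algebra.
From mathcomp Require Import complex mpoly.
From mathcomp Require Import classical_sets reals ereal sequences.

Set Implicit Arguments.
Unset Strict Implicit.
Unset Printing Implicit Defensive.

Import Order.TTheory GRing.Theory Num.Theory.

Local Open Scope classical_set_scope.
Local Open Scope ring_scope.

(* The degree-d monomials in n variables.  They are carved out of the finite
   type of monomials of degree < d.+1 in order to form a finite type. *)
Definition hmon (n d : nat) := {m : 'X_{1..n < d.+1} | mdeg m == d}.

Definition hdim (n d : nat) : nat := #|{: hmon n d}|.

(* Coefficient vector identifying R[x]_{=d} with R^(hdim n d). *)
Definition coefv (R : nzRingType) (n d : nat) (f : {mpoly R[n]}) :
    'rV[R]_(hdim n d) :=
  \row_k f@_(val (enum_val k : hmon n d)).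

Definition grad (F : comNzRingType) (n : nat) (f : {mpoly F[n]})
    (x : 'cV[F]_n) : 'cV[F]_n :=
  \col_i (f^`M(i)).@[fun k => x k 0].

Definition hess (F : comNzRingType) (n : nat) (f : {mpoly F[n]})
    (x : 'cV[F]_n) : 'M[F]_n :=
  \matrix_(i, j) (f^`M(i)^`M(j)).@[fun k => x k 0].

Definition dotv (F : comNzRingType) (n : nat) (u v : 'cV[F]_n) : F :=
  (u^T *m v) 0 0.

Section Sphere.
Context (R : realType) (n : nat).
Implicit Types (f : {mpoly R[n]}) (x u : 'cV[R]_n) (lam : R).

Definition sphere : set 'cV[R]_n := [set x | \sum_i x i 0 ^+ 2 = 1].

Definition sperp x : set 'cV[R]_n := [set u | sphere u /\ dotv u x = 0].

Definition FONC f x lam : Prop := grad f x - lam *: x = 0.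

Definition SONC f x lam : Prop :=
  forall u, sperp x u -> 0 <= dotv u (hess f x *m u) - lam.

Definition SOSC f x lam : Prop :=
  forall u, sperp x u -> 0 < dotv u (hess f x *m u) - lam.

(* The multiplier of FONC is unique on the sphere, so quantifying it
   existentially introduces no choice. *)
Definition SONC_point f x : Prop :=
  sphere x /\ exists lam, FONC f x lam /\ SONC f x lam.

Definition SOSC_point f x : Prop :=
  sphere x /\ exists lam, FONC f x lam /\ SOSC f x lam.

End Sphere.

Section Elimination.
Context (R : realType) (n d : nat).

(* [ grad f(x)    x  0 ]
   [ hess f(x) y  y  x ] *)
Definition elim_mx (F : comNzRingType) (f : {mpoly F[n]}) (x y : 'cV[F]_n) :
    'M[F]_(n + n, 1 + 1 + 1) :=
  col_mx (row_mx (row_mx (grad f x) x) 0)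
         (row_mx (row_mx (hess f x *m y) y) x).

(* dotv involves no complex conjugation. *)
Definition elim_condition (f : {mpoly R[n]}) : Prop :=
  exists x y : 'cV[R[i]]_n,
    [/\ x != 0, y != 0,
        (\rank (elim_mx (map_mpoly (real_complex R) f) x y) <= 2)%N
      & dotv y x = 0].

(* Value at f of an integer polynomial in the coefficients of f. *)
Definition coef_eval (p : {mpoly int[hdim n d]}) (f : {mpoly R[n]}) : R :=
  (map_mpoly intr p).@[coefv d f 0].

Definition elim_system (s : nat) (phis : 'I_s -> {mpoly int[hdim n d]}) :
    Prop :=
  (forall i, exists e : nat, phis i \is e.-homog) /\
  (forall f : {mpoly R[n]}, f \is d.-homog ->
     (forall i, coef_eval (phis i) f = 0) <-> elim_condition f).

Definition phi (s : nat) (phis : 'I_s -> {mpoly int[hdim n d]})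
    (f : {mpoly R[n]}) : R :=
  \sum_i coef_eval (phis i) f ^+ 2.

End Elimination.

Section Generic.
Context (R : realType).

Definition box (N : nat) (a b : 'rV[R]_N) : set 'rV[R]_N :=
  [set v | forall i, a 0 i <= v 0 i <= b 0 i].

Definition box_volume (N : nat) (a b : 'rV[R]_N) : R :=
  \prod_i (b 0 i - a 0 i).

(* Lebesgue measure zero in R^N, for N > 0: coverable by countably many boxes
   of arbitrarily small total volume. *)
Definition lebesgue_null (N : nat) (A : set 'rV[R]_N) : Prop :=
  forall eps : R, 0 < eps ->
  exists a b : nat -> 'rV[R]_N,
    [/\ forall k i, a k 0 i <= b k 0 i,
        A `<=` \bigcup_k box (a k) (b k)
      & (\sum_(0 <= k <oo) (box_volume (a k) (b k))%:E <= eps%:E)%E].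

Definition generically (n d : nat) (P : {mpoly R[n]} -> Prop) : Prop :=
  exists2 Z : set 'rV[R]_(hdim n d), lebesgue_null Z &
    forall f : {mpoly R[n]}, f \is d.-homog -> ~ Z (coefv d f) -> P f.

End Generic.

(* Main.v *)
Require Import Defs.
From HB Require Import structures.
From mathcomp Require Import all_boot all_order all_algebra.
From mathcomp Require Import complex mpoly.
From mathcomp Require Import boolp classical_sets reals ereal sequences.
From mathcomp Require Import normedtype.
From mathcomp Require Import zify ring lra.

(** Both parts rest on one observation.  At an SONC point [x] violating the
    SOSC, some unit vector [u] orthogonal to [x] minimises the quadratic form
    [hess f x] on the unit sphere of the hyperplane orthogonal to [x], with
    minimum [lam].  It is therefore an eigenvector of the form compressed to
    that hyperplane, and
      [grad f x = lam x]  and  [hess f x u = lam u + mu x]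
    ([SOSC_of_nondegenerate]).  Call this a degeneracy of [f] at [(x, u)].

    First part: the two equations say that the first column of the elimination
    matrix at [(x, u)] is a combination of the other two, so that its rank
    is at most 2, every polynomial of the elimination system vanishes at [f],
    and so does [phi].

    Second part: the coefficient vectors of the degenerate forms constitute a
    null set, because one variable fewer than the number [N] of coefficients
    suffices to parametrise them.  In degree 1 only the zero form is
    degenerate.  In degree [d >= 2], homogeneity, and subtraction of a
    multiple of [x] from [u], lead to a chart in which [x_i = 1], [w_i = 0],
    [w_j = 1] for some [i <> j], and in which, with one further scalar [c],
      [grad f x = c |x|^2 x],
      [hess f x w = c |x|^2 w + c (d - 2) (x . w) x]
    ([degenerate_normal_form]; the last coefficient is forced by the relation
    of Euler).  A unimodular linear substitution moves [x] and [w] to the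
    coordinate vectors [e_i] and [e_j].  There the two equations merely
    prescribe the [2n - 1] coefficients of [f] at the monomials
    [X_i^(d-1) X_k] and [X_i^(d-2) X_j X_k].  The chart data [(x, w, c)]
    consist of [(n - 1) + (n - 2) + 1 = 2n - 2] scalars, so they can be stored
    in the places of the prescribed coefficients, with one place, that of
    [X_i^(d-2) X_j^2], to spare.  Hence every degenerate form is the value of
    one of finitely many polynomial maps from R^N to R^N at a point of a
    coordinate hyperplane ([degenerate_form_onto]).

    Polynomial maps are Lipschitz on cubes, and the image of a piece of a
    hyperplane under such a map is null, by covering it with the images of
    the cells of a fine grid: [O(K^(N-1))] cells have images in boxes of volume
    [O(K^(-N))] ([content_null_hyperplane_image]). *)

Set Implicit Arguments.
Unset Strict Implicit.
Unset Printing Implicit Defensive.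

Import Order.TTheory GRing.Theory Num.Theory.

Local Open Scope classical_set_scope.
Local Open Scope ring_scope.

(** * Degenerate critical pairs and the elimination matrix *)

Section Dot.
Context (F : comNzRingType) (n : nat).
Implicit Types (u v w x : 'cV[F]_n) (A : 'M[F]_n).

Lemma dotvE u v : dotv u v = \sum_i u i 0 * v i 0.
Proof. by rewrite /dotv mxE; apply: eq_bigr => i _; rewrite mxE. Qed.

Lemma dotvC u v : dotv u v = dotv v u.
Proof. by rewrite !dotvE; apply: eq_bigr => i _; rewrite mulrC. Qed.

Lemma dotvDr u v w : dotv u (v + w) = dotv u v + dotv u w.
Proof. by rewrite /dotv mulmxDr mxE. Qed.

Lemma dotvDl u v w : dotv (v + w) u = dotv v u + dotv w u.
Proof. by rewrite dotvC dotvDr !(dotvC u). Qed.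

Lemma dotvZr a u v : dotv u (a *: v) = a * dotv u v.
Proof. by rewrite /dotv -scalemxAr mxE. Qed.

Lemma dotvZl a u v : dotv (a *: u) v = a * dotv u v.
Proof. by rewrite dotvC dotvZr dotvC. Qed.

Lemma dotvNr u v : dotv u (- v) = - dotv u v.
Proof. by rewrite -scaleN1r dotvZr mulN1r. Qed.

Lemma dotvNl u v : dotv (- u) v = - dotv u v.
Proof. by rewrite dotvC dotvNr dotvC. Qed.

Lemma dotv0r u : dotv u 0 = 0.
Proof. by rewrite /dotv mulmx0 mxE. Qed.

Lemma dotv_symmx A u v : A^T = A -> dotv u (A *m v) = dotv v (A *m u).
Proof.
move=> sA; rewrite [RHS]dotvC /dotv trmx_mul sA.
by rewrite mulmxA.
Qed.

Lemma hess_sym (f : {mpoly F[n]}) x : (hess f x)^T = hess f x.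
Proof. by apply/matrixP => i j; rewrite !mxE mderiv_comm. Qed.

End Dot.

Definition dotvE_lin := (dotvDl, dotvDr, dotvZl, dotvZr, dotvNl, dotvNr).

Section FirstOrder.
Context (R : realType) (n : nat).
Implicit Types (u v w x : 'cV[R]_n) (A : 'M[R]_n).

Lemma dotv_ge0 u : 0 <= dotv u u.
Proof. by rewrite dotvE; apply: sumr_ge0 => i _; rewrite -expr2 sqr_ge0. Qed.

Lemma dotv_eq0 u : dotv u u = 0 -> u = 0.
Proof.
rewrite dotvE => /eqP; rewrite psumr_eq0; last first.
  by move=> i _; rewrite -expr2 sqr_ge0.
move=> /allP h; apply/colP => i; rewrite mxE.
have /= := h i (mem_index_enum i).
by rewrite mulf_eq0 orbb => /eqP.
Qed.

Lemma sphereE x : sphere x <-> dotv x x = 1.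
Proof.
rewrite /sphere /= dotvE.
by under [X in _ <-> X = 1]eq_bigr => i _ do rewrite -expr2.
Qed.

Lemma linear_term_eq0 (b c : R) :
  (forall t, 0 <= t * b *+ 2 + t ^+ 2 * c) -> b = 0.
Proof.
move=> h; have [c0|c0] := leP 0 c.
  (* The minimiser is [- b / c]; dividing by [c + 1] avoids the case [c = 0]. *)
  have c1 : c + 1 != 0 by lra.
  have := h (- b / (c + 1)).
  have -> : - b / (c + 1) * b *+ 2 + (- b / (c + 1)) ^+ 2 * c =
    - (b ^+ 2 * ((c + 2) / (c + 1) ^+ 2)) by field.
  rewrite oppr_ge0 pmulr_lle0; last by rewrite divr_gt0 ?exprn_gt0; lra.
  by move=> b0; apply/eqP; rewrite -sqrf_eq0 eq_le b0 sqr_ge0.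
have := h 1; have := h (-1); nra.
Qed.

(** A minimiser [u] of a quadratic form on the unit sphere of the hyperplane
    orthogonal to [x] is an eigenvector of the compressed form: in the
    direction of the component of [A u - lam u] orthogonal to [x] the
    form would otherwise decrease to first order. *)
Lemma constrained_eigenvector A x u lam :
  A^T = A -> sphere x -> sperp x u ->
  (forall v, sperp x v -> 0 <= dotv v (A *m v) - lam) ->
  dotv u (A *m u) - lam = 0 ->
  exists mu, A *m u = lam *: u + mu *: x.
Proof.
move=> sA /sphereE xx [/sphereE uu ux] Age0 Au.
(* By homogeneity the inequality extends from unit vectors to the hyperplane. *)
have q_ge0 v : dotv v x = 0 -> 0 <= dotv v (A *m v) - lam * dotv v v.
  move=> vx; have [/dotv_eq0 ->|v0] := eqVneq (dotv v v) 0.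
    by rewrite mulmx0 dotv0r mulr0 subr0.
  have vgt0 : 0 < dotv v v by rewrite lt_neqAle eq_sym v0 dotv_ge0.
  pose r := Num.sqrt (dotv v v).
  have r2 : r ^+ 2 = dotv v v by rewrite sqr_sqrtr // ltW.
  have r0 : r != 0 by rewrite sqrtr_eq0 -ltNge.
  have := Age0 (r^-1 *: v); rewrite -scalemxAr !dotvE_lin => h.
  have : 0 <= r^-1 * (r^-1 * dotv v (A *m v)) - lam.
    apply: h; split; last by rewrite dotvZl vx mulr0.
    by apply/sphereE; rewrite !dotvE_lin -r2; field.
  rewrite -(pmulr_rge0 _ vgt0) -r2.
  suff -> : r ^+ 2 * (r^-1 * (r^-1 * dotv v (A *m v)) - lam) =
    dotv v (A *m v) - lam * r ^+ 2 by [].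
  by field.
have [r rdef] : exists r, r = A *m u - lam *: u by eexists.
exists (dotv x r).
have [w wdef] : exists w, w = r - dotv x r *: x by eexists.
have wx : dotv w x = 0 by rewrite wdef !dotvE_lin xx mulr1 (dotvC r) subrr.
suff wr : dotv w r = 0.
  have : dotv w w = 0.
    by rewrite {2}wdef !dotvE_lin wx wr mulr0 subrr.
  move/dotv_eq0/eqP; rewrite wdef subr_eq0 => /eqP <-.
  by rewrite rdef addrC subrK.
(* [dotv w r] is half the derivative of the nonnegative form at its zero [u]
   in the direction [w]. *)
apply: (@linear_term_eq0 _ (dotv w (A *m w) - lam * dotv w w)) => t.
rewrite rdef; have := q_ge0 (u + t *: w).
rewrite !dotvE_lin ux wx mulr0 addr0 => /(_ erefl).
rewrite mulmxDr -scalemxAr !dotvE_lin (dotv_symmx u w sA) (dotvC u w).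
move: Au; rewrite uu => /eqP; rewrite subr_eq0 => /eqP ->.
by move=> h; lra.
Qed.

End FirstOrder.

(** For a multiplier [lam] of [x], the vector [u] is a null direction of the
    Hessian [hess f x - lam] of the Lagrangian, bordered by the normal [x] of
    the sphere. *)
Definition degenerate_at (F : comNzRingType) (n : nat) (f : {mpoly F[n]})
    (x u : 'cV[F]_n) (lam mu : F) : Prop :=
  grad f x = lam *: x /\ hess f x *m u = lam *: u + mu *: x.

(** Where the SONC holds and the SOSC fails, the failure is an equality, and the
    vector attaining it minimises the Hessian form. *)
Lemma SOSC_of_nondegenerate (R : realType) (n : nat) (f : {mpoly R[n]})
    (x : 'cV[R]_n) :
  (forall u lam mu, dotv x x = 1 -> dotv u u = 1 -> dotv u x = 0 ->
     ~ degenerate_at f x u lam mu) ->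
  SONC_point f x -> SOSC_point f x.
Proof.
move=> nd [sx [lam [fo so]]]; split=> //; exists lam; split=> // u xu.
rewrite lt_neqAle so // andbT; apply/eqP => /esym hu.
have [mu muE] := constrained_eigenvector (hess_sym f x) sx xu so hu.
case: xu => /sphereE su ux; move/sphereE: sx => sx.
case: (nd u lam mu sx su ux); split=> //.
by move/eqP: fo; rewrite subr_eq0 => /eqP.
Qed.

Lemma mderiv_map_mpoly (R S : nzRingType) (g : {rmorphism R -> S}) (n : nat)
    (i : 'I_n) (p : {mpoly R[n]}) :
  (map_mpoly g p)^`M(i) = map_mpoly g p^`M(i).
Proof.
by apply/mpolyP => m; rewrite mcoeff_mderiv !mcoeff_map_mpoly mcoeff_mderiv raddfMn.
Qed.

Lemma meval_map_mpoly (R S : comNzRingType) (g : {rmorphism R -> S}) (n : nat)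
    (v : 'I_n -> R) (p : {mpoly R[n]}) :
  (map_mpoly g p).@[fun i => g (v i)] = g p.@[v].
Proof.
rewrite {1 2}[p]mpolyE (raddf_sum (map_mpoly g)) (raddf_sum (meval _)) /=.
rewrite (raddf_sum (meval v)) (raddf_sum g) /=; apply: eq_bigr => m _.
rewrite map_mpolyZ map_mpolyX !mevalZ !mevalX rmorphM rmorph_prod.
by congr (_ * _); apply: eq_bigr => i _; rewrite rmorphXn.
Qed.

Section MapDegenerate.
Context (F G : comNzRingType) (g : {rmorphism F -> G}) (n : nat).
Implicit Types (f : {mpoly F[n]}) (x u : 'cV[F]_n).

Lemma grad_map f x : grad (map_mpoly g f) (map_mx g x) = map_mx g (grad f x).
Proof.
apply/colP => i; rewrite !mxE mderiv_map_mpoly -meval_map_mpoly.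
by apply: meval_eq => k; rewrite !mxE.
Qed.

Lemma hess_map f x : hess (map_mpoly g f) (map_mx g x) = map_mx g (hess f x).
Proof.
apply/matrixP => i j; rewrite !mxE !mderiv_map_mpoly -meval_map_mpoly.
by apply: meval_eq => k; rewrite !mxE.
Qed.

End MapDegenerate.

(** The degeneracy equations say that [(1, -lam, -mu)] lies in the kernel of
    the elimination matrix. *)
Lemma degenerate_rank (F : fieldType) (n : nat) (f : {mpoly F[n]}) x u lam mu :
  degenerate_at f x u lam mu -> (\rank (elim_mx f x u) <= 2)%N.
Proof.
move=> [gE hE].
pose c : 'M[F]_(1 + 1 + 1, 1) :=
  col_mx (col_mx (1%:M : 'M_1) (- lam)%:M) (- mu)%:M.
have Ec : elim_mx f x u *m c = 0.
  rewrite /elim_mx /c mul_col_mx !mul_row_col !mul_mx_scalar gE hE.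
  rewrite !scale1r !scaler0 !addr0 !scaleNr subrr.
  rewrite [X in col_mx _ X](_ : _ = 0) ?col_mx0 //.
  by rewrite addrAC addrK subrr.
have c0 : \rank c = 1%N.
  apply/eqP; rewrite eqn_leq rank_leq_col lt0n mxrank_eq0.
  apply/eqP => /(congr1 (fun M : 'M_(1 + 1 + 1, 1) => usubmx (usubmx M))).
  rewrite !col_mxKu !linear0 => /matrixP /(_ 0 0).
  by rewrite !mxE => /eqP; rewrite oner_eq0.
by have := mulmx0_rank_max Ec; rewrite c0 addn1 ltnS.
Qed.

Lemma degenerate_elim (R : realType) (n : nat) (f : {mpoly R[n]}) x u lam mu :
  x != 0 -> u != 0 -> dotv u x = 0 -> degenerate_at f x u lam mu ->
  elim_condition f.
Proof.
move=> x0 u0 ux [gE hE]; pose g := real_complex R.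
(* The real pair serves as the complex one: both vectors being real, the
   bilinear orthogonality is the Euclidean one. *)
exists (map_mx g x), (map_mx g u); split.
- by rewrite map_mx_eq0.
- by rewrite map_mx_eq0.
- apply: (@degenerate_rank _ _ _ _ _ (g lam) (g mu)); split.
    by rewrite grad_map gE map_mxZ.
  by rewrite hess_map -map_mxM hE map_mxD !map_mxZ.
- by rewrite /dotv map_trmx -map_mxM mxE -/(dotv u x) ux rmorph0.
Qed.

Lemma dotv1_neq0 (R : realType) (n : nat) (x : 'cV[R]_n) :
  dotv x x = 1 -> x != 0.
Proof.
by move=> x1; apply/eqP => x0; move/eqP: x1; rewrite x0 dotv0r eq_sym oner_eq0.
Qed.

Lemma phi_neq0_SOSC (R : realType) (n d s : nat)
    (phis : 'I_s -> {mpoly int[hdim n d]}) (f : {mpoly R[n]}) (x : 'cV[R]_n) :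
  elim_system R phis -> f \is d.-homog -> phi phis f <> 0 ->
  SONC_point f x -> SOSC_point f x.
Proof.
move=> [_ es] fd phi0; apply: SOSC_of_nondegenerate => u lam mu x1 u1 ux deg.
apply: phi0; rewrite /phi big1 // => i _.
have [_ ->] := es f fd; first by rewrite expr0n.
exact: degenerate_elim (dotv1_neq0 x1) (dotv1_neq0 u1) ux deg.
Qed.

(** * Null sets *)

Section Concatenation.
Context (R : realDomainType) (T : eqType) (L : nat -> seq T).
Hypothesis Lne : forall m, (0 < size (L m))%N.
Let Lcat m := flatten [seq L i | i <- iota 0 m].

Let x0 : T.
Proof. by case: (L 0) (Lne 0) => [|x _] //= _; exact: x. Defined.

Let LcatS m : Lcat m.+1 = Lcat m ++ L m.
Proof. by rewrite /Lcat -[m.+1]addn1 iotaD map_cat flatten_cat /= cats0. Qed.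

Let size_Lcat m : (m <= size (Lcat m))%N.
Proof.
elim: m => [//|m IH]; rewrite LcatS size_cat.
by rewrite -[m.+1]addn1 leq_add.
Qed.

Let nth_Lcat k p q : (k < size (Lcat p))%N -> (p <= q)%N ->
  nth x0 (Lcat q) k = nth x0 (Lcat p) k.
Proof.
move=> kp /subnK <-; elim: (q - p)%N => [//|r IH].
rewrite addSn LcatS nth_cat ifT //.
apply: leq_trans kp _; elim: r {IH} => [//|r IH].
by rewrite addSn LcatS size_cat (leq_trans IH) ?leq_addr.
Qed.

Let entry k := nth x0 (Lcat k.+1) k.

Let entryE k p : (k < size (Lcat p))%N -> entry k = nth x0 (Lcat p) k.
Proof.
move=> kp; have [kp'|/ltnW pk] := leqP k.+1 p.
  by rewrite (@nth_Lcat k k.+1 p).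
by rewrite -(@nth_Lcat k p k.+1).
Qed.

(** The lists [L 0], [L 1], ... are laid end to end; as none is empty, the
    first [n] of them contain the first [n] entries of the result. *)
Lemma concat_seqs : exists B : nat -> T,
  [/\ forall k, exists m, B k \in L m,
      forall m x, x \in L m -> exists k, B k = x
    & forall (F : T -> R) n, (forall m x, x \in L m -> 0 <= F x) ->
        \sum_(k < n) F (B k) <= \sum_(m < n) \sum_(x <- L m) F x].
Proof.
have bE m ab : ab \in L m -> exists k, entry k = ab.
  move=> /(nthP x0) [l lm <-]; exists (size (Lcat m) + l)%N.
  rewrite (@entryE _ m.+1) LcatS; last by rewrite size_cat ltn_add2l.
  by rewrite nth_cat ltnNge leq_addr /= addKn.
exists entry; split=> //.
  move=> k; have : entry k \in Lcat k.+1 by rewrite mem_nth.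
  by case/flatten_mapP => m _ km; exists m.
move=> F n F0.
have -> : \sum_(m < n) \sum_(x <- L m) F x = \sum_(x <- Lcat n) F x.
  by rewrite big_flatten /= big_map -[in RHS](subn0 n) big_mkord.
rewrite (big_nth x0) -(subnKC (size_Lcat n)) big_mkord big_split_ord /=.
rewrite (eq_bigr (fun k : 'I_n => F (nth x0 (Lcat n) k))); last first.
  by move=> k _; rewrite (@entryE _ n) // (leq_trans (ltn_ord k)).
rewrite lerDl; apply: sumr_ge0 => k _.
have : nth x0 (Lcat n) (n + k) \in Lcat n.
  by rewrite mem_nth // -ltn_subRL.
by case/flatten_mapP => m _; exact: F0.
Qed.

End Concatenation.

Section NullSets.
Context (R : realType) (N : nat).
Implicit Types (A : set 'rV[R]_N) (L : seq ('rV[R]_N * 'rV[R]_N)).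

Definition total_volume L : R := \sum_(ab <- L) box_volume ab.1 ab.2.

Definition covers L A : Prop :=
  [/\ forall ab, ab \in L -> forall i, ab.1 0 i <= ab.2 0 i
    & forall v, A v -> exists2 ab, ab \in L & box ab.1 ab.2 v].

(** Jordan content zero.  Unlike covers by infinite families, covers by finite
    lists can be merged by laying the lists end to end. *)
Definition content_null A : Prop :=
  forall eps : R, 0 < eps -> exists2 L, covers L A & total_volume L <= eps.

Lemma box_volume_ge0 (a b : 'rV[R]_N) :
  (forall i, a 0 i <= b 0 i) -> 0 <= box_volume a b.
Proof. by move=> ab; apply: prodr_ge0 => i _; rewrite subr_ge0. Qed.


Lemma content_null_point (v : 'rV[R]_N) : (0 < N)%N -> content_null [set v].
Proof.
move=> N0 eps e0; exists [:: (v, v)]; last first.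
  rewrite /total_volume big_seq1 /box_volume (bigD1 (Ordinal N0)) //=.
  by rewrite subrr mul0r ltW.
split=> [ab|_ ->]; first by rewrite inE => /eqP ->.
by exists (v, v); rewrite ?inE // => i /=; rewrite lexx.
Qed.

Lemma content_null0 : content_null set0.
Proof.
by move=> eps e0; exists [::]; rewrite ?/total_volume ?big_nil ?ltW.
Qed.


Lemma lebesgue_null_bigcup (I : countType) (A : I -> set 'rV[R]_N) :
  (0 < N)%N -> (forall c, content_null (A c)) -> lebesgue_null (\bigcup_c A c).
Proof.
move=> N0 nA eps e0.
pose A' m := if @unpickle I m is Some c then A c else set0.
have nA' m : content_null (A' m).
  by rewrite /A'; case: unpickle => [c|]; [exact: nA|exact: content_null0].
have /choice[L LP] : forall m, exists L, [/\ covers L (A' m),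
    (0 < size L)%N & total_volume L <= eps / 2 ^+ m.+1].
  move=> m; have [|L [Lab LA] Lv] := nA' m (eps / 2 ^+ m.+1).
    by rewrite divr_gt0 ?exprn_gt0.
  (* A degenerate box makes every list nonempty at no cost in volume. *)
  exists ((0, 0) :: L); split=> //.
    split=> [ab|v /LA[ab abL abv]]; last by exists ab; rewrite // inE abL orbT.
    by rewrite inE => /orP[/eqP -> //|/Lab].
  rewrite /total_volume big_cons /box_volume (bigD1 (Ordinal N0)) //=.
  by rewrite subrr mul0r add0r.
have [|B [BL LB Bsum]] := @concat_seqs R _ L; first by move=> m; have [] := LP m.
have Bab k i : (B k).1 0 i <= (B k).2 0 i.
  by have [m Bm] := BL k; have [[h _] _ _] := LP m; exact: h.
exists (fun k => (B k).1), (fun k => (B k).2); split=> //.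
  move=> v [c _ Acv].
  have [[_ h] _ _] := LP (pickle c).
  have [|ab abL abv] := h v; first by rewrite /A' pickleK.
  by have [k kE] := LB _ _ abL; exists k; rewrite // kE.
apply: lime_le.
  by apply: is_cvg_nneseries => k _ _; rewrite lee_fin box_volume_ge0.
near=> n; rewrite /= sumEFin lee_fin big_mkord.
apply: le_trans (Bsum (fun ab => box_volume ab.1 ab.2) n _) _.
  by move=> m ab abL; apply: box_volume_ge0; have [[h _] _ _] := LP m; exact: h.
have : \sum_(m < n) total_volume (L m) <= \sum_(m < n) eps / 2 ^+ m.+1.
  by apply: ler_sum => m _; have [] := LP m.
move/le_trans; apply.
suff -> : \sum_(m < n) eps / 2 ^+ m.+1 = eps - eps / 2 ^+ n.
  by rewrite gerBl ltW // divr_gt0 ?exprn_gt0.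
elim: (n : nat) => [|k IH]; first by rewrite big_ord0 expr0 divr1 subrr.
rewrite big_ord_recr /= IH exprS; field.
by rewrite expf_neq0.
Unshelve. all: by end_near.
Qed.

End NullSets.

(** * Images of hyperplanes under Lipschitz maps *)

Section BoundedLipschitz.
Context (R : realType) (N : nat).
Implicit Types (s t : 'rV[R]_N) (g h : 'rV[R]_N -> R).

Definition in_cube (M : R) t : Prop := forall i, `|t 0 i| <= M.

(** Lipschitz on every cube for the maximum norm: all polynomial functions
    are, and sums and products stay in the class. *)
Definition cube_lipschitz g : Prop :=
  forall M : R, 0 <= M -> exists2 C : R, 0 <= C &
    forall s t delta, in_cube M s -> in_cube M t -> 0 <= delta ->
      in_cube delta (s - t) -> `|g s - g t| <= C * delta.

(** Needed for products: the factors have to be bounded. *)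
Lemma cube_lipschitz_bounded g (M : R) : cube_lipschitz g -> 0 <= M ->
  exists2 B : R, 0 <= B & forall t, in_cube M t -> `|g t| <= B.
Proof.
move=> lg M0; have [C C0 Cg] := lg M M0.
exists (`|g 0| + C * M) => [|t tM]; first by rewrite addr_ge0 ?mulr_ge0.
rewrite -[g t](subrK (g 0)) addrC (le_trans (ler_normD _ _)) // lerD2l.
by apply: Cg; rewrite ?subr0 // => i; rewrite mxE normr0.
Qed.

Lemma cube_lipschitz_cst c : cube_lipschitz (fun=> c).
Proof.
by move=> M M0; exists 0 => // s t d _ _ d0 _; rewrite subrr normr0 mul0r.
Qed.

Lemma cube_lipschitz_coord i : cube_lipschitz (fun t => t 0 i).
Proof.
move=> M M0; exists 1 => // s t d _ _ d0 /(_ i).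
by rewrite !mxE mul1r.
Qed.

Lemma cube_lipschitzD g h : cube_lipschitz g -> cube_lipschitz h ->
  cube_lipschitz (fun t => g t + h t).
Proof.
move=> lg lh M M0; have [C C0 Cg] := lg M M0; have [D D0 Dh] := lh M M0.
exists (C + D) => [|s t d sM tM d0 st]; first exact: addr_ge0.
rewrite opprD addrACA mulrDl (le_trans (ler_normD _ _)) // lerD //.
  exact: Cg.
exact: Dh.
Qed.

Lemma cube_lipschitzM g h : cube_lipschitz g -> cube_lipschitz h ->
  cube_lipschitz (fun t => g t * h t).
Proof.
move=> lg lh M M0; have [C C0 Cg] := lg M M0; have [D D0 Dh] := lh M M0.
have [A A0 Ag] := cube_lipschitz_bounded lg M0.
have [B B0 Bh] := cube_lipschitz_bounded lh M0.
exists (A * D + C * B) => [|s t d sM tM d0 st]; first by rewrite addr_ge0 ?mulr_ge0.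
have -> : g s * h s - g t * h t = g s * (h s - h t) + (g s - g t) * h t by ring.
rewrite (le_trans (ler_normD _ _)) // !normrM mulrDl -mulrA lerD //.
  by apply: ler_pM => //; [exact: Ag|exact: Dh].
by rewrite mulrAC; apply: ler_pM => //; [exact: Cg|exact: Bh].
Qed.


Lemma cube_lipschitz_sum (I : Type) (r : seq I) (P : pred I)
    (g : I -> 'rV[R]_N -> R) : (forall i, P i -> cube_lipschitz (g i)) ->
  cube_lipschitz (fun t => \sum_(i <- r | P i) g i t).
Proof.
move=> lg; elim: r => [|i r IH].
  by under eq_fun do rewrite big_nil; exact: cube_lipschitz_cst.
under eq_fun do rewrite big_cons.
by case Pi: (P i) => //; apply: cube_lipschitzD => //; exact: lg.
Qed.


Section HyperplaneImage.
Context (k0 : 'I_N) (Phi : 'rV[R]_N -> 'rV[R]_N).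
Hypothesis Phi_lip : forall i, cube_lipschitz (fun t => Phi t 0 i).

Lemma common_lipschitz_constant (M : R) : 0 <= M ->
  exists2 C : R, 0 <= C & forall s t delta, in_cube M s -> in_cube M t ->
    0 <= delta -> in_cube delta (s - t) -> in_cube (C * delta) (Phi s - Phi t).
Proof.
move=> M0; have /fin_all_exists[C CP] : forall i, exists C, 0 <= C /\
    forall s t delta, in_cube M s -> in_cube M t -> 0 <= delta ->
      in_cube delta (s - t) -> `|Phi s 0 i - Phi t 0 i| <= C * delta.
  by move=> i; have [C C0 CP] := Phi_lip i M0; exists C.
exists (\sum_i C i) => [|s t d sM tM d0 st i].
  by apply: sumr_ge0 => i _; have [] := CP i.
rewrite !mxE; have [_ h] := CP i.
apply: le_trans (h s t d sM tM d0 st) _; apply: ler_wpM2r => //.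
rewrite (bigD1 i) //= lerDl; apply: sumr_ge0 => j _.
by have [] := CP j.
Qed.

Let P := {i : 'I_N | i != k0}.

Let cardP : #|{: P}| = N.-1.
Proof. by rewrite card_sig -[N in RHS]card_ord -(cardC1 k0); apply: eq_card. Qed.

(** The part of the hyperplane in a cube is covered by [(2 K + 1) ^ (N - 1)]
    cubes of side [O(1 / K)], whose images lie in boxes of volume
    [O(1 / K ^ N)]. *)
Lemma content_null_hyperplane_image (M : R) : 0 < M ->
  content_null [set Phi t | t in [set t | in_cube M t /\ t 0 k0 = 0]].
Proof.
move=> M0 eps e0; have [C C0 CP] := common_lipschitz_constant (ltW M0).
(* [W / K] bounds the total volume obtained below from a grid of mesh
   [M / K], as [2 K + 1 <= 3 K]. *)
pose W := 3 ^+ N.-1 * (2 * C * M) ^+ N.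
have W0 : 0 <= W by rewrite mulr_ge0 ?exprn_ge0 ?mulr_ge0 // ltW.
pose K := (Num.trunc (W / eps)).+1.
have K0 : 0 < K%:R :> R by rewrite ltr0n.
have WK : W / K%:R <= eps.
  rewrite ler_pdivrMr // mulrC -ler_pdivrMr //.
  by have /andP[_ /ltW] := @truncn_itv _ (W / eps) (divr_ge0 W0 (ltW e0)).
pose h := M / K%:R.
have h0 : 0 < h by rewrite divr_gt0.
have hK : h * K%:R = M by rewrite divfK // gt_eqF.
pose cell := {ffun P -> 'I_(2 * K).+1}.
(* The default value 0 at [k0] puts the nodes in the hyperplane. *)
pose node (q : cell) : 'rV[R]_N :=
  \row_i if insub i is Some p then - M + h * (q p)%:R else 0.
have node_in q : in_cube M (node q).
  move=> i; rewrite mxE; case: insub => [p|]; last by rewrite normr0 ltW.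
  have qK : (q p)%:R <= 2 * K%:R :> R by rewrite -natrM ler_nat -ltnS.
  have : h * (q p)%:R <= h * (2 * K%:R) by rewrite ler_pM2l.
  have : 0 <= h * (q p)%:R by rewrite mulr_ge0 // ltW.
  by rewrite ler_norml => ? ?; apply/andP; split; lra.
pose e : 'rV[R]_N := const_mx (C * h).
pose L := [seq (Phi (node q) - e, Phi (node q) + e) | q : cell].
exists L.
  split=> [ab /mapP[q _ ->] i /=|_ [t [tM tk0] <-]].
    by rewrite !mxE lerD2l ge0_cp ?mulr_ge0 // ltW.
  have t_ge0 i : 0 <= (t 0 i + M) / h.
    by rewrite divr_ge0 ?(ltW h0) //; have := tM i; rewrite ler_norml; lra.
  have trunc_lt i : (Num.trunc ((t 0%R i + M) / h)%R < (2 * K).+1)%N.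
    rewrite ltnS -(ler_nat R).
    have /andP[/le_trans + _] := truncn_itv (t_ge0 i); apply.
    rewrite ler_pdivrMr // natrM -mulrA [K%:R * h]mulrC hK.
    by have := tM i; rewrite ler_norml; lra.
  pose q : cell := [ffun p => Ordinal (trunc_lt (val p))].
  exists (Phi (node q) - e, Phi (node q) + e).
    by apply/mapP; exists q; rewrite ?mem_enum.
  move=> i /=.
  have : in_cube (C * h) (Phi t - Phi (node q)).
    apply: CP => //; first exact: ltW.
    move=> j; rewrite !mxE; case: insubP => [p _ pj|]; last first.
      by rewrite negbK => /eqP ->; rewrite tk0 subr0 normr0 ltW.
    rewrite ffunE /= -pj; move: (truncn_itv (t_ge0 (val p))).
    set z := (Num.trunc _)%:R; rewrite ler_pdivlMr // ltr_pdivrMr //.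
    rewrite -natr1 -/z => /andP[? ?]; rewrite ler_norml.
    by apply/andP; split; lra.
  move/(_ i); rewrite !mxE ler_norml => /andP[? ?].
  by apply/andP; split; lra.
apply: le_trans WK; rewrite /total_volume big_map.
rewrite (eq_bigr (fun=> (2 * C * h) ^+ N)); last first.
  move=> q _; rewrite /box_volume (eq_bigr (fun=> 2 * C * h)).
    by rewrite prodr_const card_ord.
  by move=> i _; rewrite !mxE /=; ring.
rewrite big_enum /= sumr_const card_ffun card_ord cardP.
rewrite -[X in X <= _]mulr_natr natrX.
have N0 : (0 < N)%N by rewrite (leq_ltn_trans _ (ltn_ord k0)).
have -> : (2 * C * h) ^+ N = (2 * C * M) ^+ N / (K%:R ^+ N.-1 * K%:R).
  by rewrite /h mulrA expr_div_n -exprSr prednK.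
have -> : W / K%:R = (2 * C * M) ^+ N / (K%:R ^+ N.-1 * K%:R) * (3 * K%:R) ^+ N.-1.
  rewrite /W [(3 * _) ^+ _]exprMn; have := gt_eqF K0; move: (K%:R) => k /negbT k0'.
  by move: (_ ^+ N) => X; field; rewrite k0' expf_neq0.
apply: ler_wpM2l; first by rewrite divr_ge0 ?exprn_ge0 ?mulr_ge0 ?exprn_ge0 // ltW.
apply: lerXn2r; rewrite ?nnegrE //.
by rewrite -natrM ler_nat /K; lia.
Qed.

End HyperplaneImage.

End BoundedLipschitz.

(** * Homogeneous polynomials and linear substitutions *)

Section Homogeneous.
Context (F : comNzRingType) (n : nat).
Implicit Types (p q : {mpoly F[n]}) (v : 'I_n -> F).

Lemma mderiv_homog d p k : p \is d.-homog -> p^`M(k) \is d.-1.-homog.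
Proof.
move=> /dhomogP hp; apply/dhomogP => m.
rewrite mcoeff_msupp mcoeff_mderiv => h.
have : (m + U_(k))%MM \in msupp p.
  by rewrite mcoeff_msupp; apply: contraNneq h => ->; rewrite mul0rn.
by move/hp => /= <-; rewrite mdegD mdeg1 addn1.
Qed.

Lemma meval_homog_scale d p c v : p \is d.-homog ->
  p.@[fun i => c * v i] = c ^+ d * p.@[v].
Proof.
move=> /dhomogP hp; rewrite !mevalE mulr_sumr !big_seq; apply: eq_bigr => m /hp /= <-.
under eq_bigr do rewrite exprMn.
by rewrite big_split /= prodrXr -mdegE mulrCA.
Qed.

(** The relation of Euler, checked on monomials. *)
Lemma euler d p v : p \is d.-homog ->
  \sum_k (p^`M(k)).@[v] * v k = d%:R * p.@[v].
Proof.
move=> /dhomogP hp.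
have X m : \sum_k ('X_[m])^`M(k).@[v] * v k = (mdeg m)%:R * ('X_[m]).@[v].
  rewrite mdegE natr_sum mulr_suml; apply: eq_bigr => k _.
  rewrite mderivX mevalZ -mulrA; have [->|mk] := posnP (m k).
    by rewrite !mul0r.
  congr (_ * _); rewrite -[v k](mevalXU v k) -mevalM -mpolyXD submK //.
  by rewrite lep1mP -lt0n.
rewrite [in LHS](mpolyE p) [in RHS](mpolyE p) (raddf_sum (meval v)) mulr_sumr.
under eq_bigr => k _.
  rewrite (raddf_sum (mderiv k)) (raddf_sum (meval v)) mulr_suml.
  under eq_bigr do rewrite /= mderivZ mevalZ -mulrA.
  over.
rewrite exchange_big /= !big_seq; apply: eq_bigr => m /hp /= md.
by rewrite -mulr_sumr X md mevalZ mulrCA.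
Qed.

(** On a coordinate vector only the pure power survives. *)
Lemma meval_homog_delta d p i : p \is d.-homog ->
  p.@[fun k => (k == i)%:R] = p@_(U_(i) *+ d)%MM.
Proof.
move=> hp; rewrite [in LHS](mpolyE p) (raddf_sum (meval _)) /=.
have ev m : ('X_[m] : {mpoly F[n]}).@[fun k => (k == i)%:R] =
    (m == (U_(i) *+ mdeg m)%MM)%:R.
  rewrite mevalX; have [/eqP mE|/eqP mN] := boolP (m == _).
    rewrite big1 // => k _; rewrite mE mulmnE mnm1E eq_sym.
    by case: eqP => _; rewrite ?expr1n // mul0n expr0.
  have /existsP[k /andP[ki mk]] : [exists k, (k != i) && (m k != 0)%N].
    apply: contraT => /existsPn h; case: mN.
    have m0 k : k != i -> m k = 0%N.
      by move=> ki; move: (h k); rewrite ki negbK => /eqP.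
    apply/mnmP => k; rewrite mulmnE mnm1E mdegE (bigD1 i) //= big1 // addn0.
    by have [<-|ki] := eqVneq; rewrite ?mul1n // mul0n m0 // eq_sym.
  by rewrite (bigD1 k) //= (negbTE ki) expr0n (negbTE mk) mul0r.
rewrite [LHS](_ : _ = \sum_(m <- msupp p) p@_m * (m == (U_(i) *+ d)%MM)%:R); last first.
  rewrite !big_seq; apply: eq_bigr => m mp; rewrite mevalZ ev.
  by have /dhomogP/(_ m mp) /= -> := hp.
have [ip|ip] := boolP ((U_(i) *+ d)%MM \in msupp p); last first.
  rewrite (memN_msupp_eq0 ip) big_seq big1 // => m mp.
  by case: eqP => [mE|_]; [rewrite -mE mp in ip|rewrite mulr0].
rewrite (bigD1_seq _ ip) ?msupp_uniq //= eqxx mulr1 big1 ?addr0 // => m /negbTE ->.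
by rewrite mulr0.
Qed.

Lemma grad_scale d (f : {mpoly F[n]}) c x : f \is d.-homog ->
  grad f (c *: x) = c ^+ d.-1 *: grad f x.
Proof.
move=> /mderiv_homog hf; apply/colP => k; rewrite !mxE.
by rewrite -(meval_homog_scale _ _ (hf k)); apply: meval_eq => l; rewrite mxE.
Qed.

Lemma hess_scale d (f : {mpoly F[n]}) c x : f \is d.-homog ->
  hess f (c *: x) = c ^+ d.-2 *: hess f x.
Proof.
move=> /mderiv_homog hf; apply/matrixP => k l; rewrite !mxE.
rewrite -(meval_homog_scale _ _ (mderiv_homog l (hf k))).
by apply: meval_eq => m; rewrite mxE.
Qed.

Lemma hess_euler d (f : {mpoly F[n]}) x : f \is d.-homog ->
  hess f x *m x = d.-1%:R *: grad f x.
Proof.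
move=> /mderiv_homog hf; apply/colP => k; rewrite !mxE -(euler _ (hf k)).
by apply: eq_bigr => l _; rewrite mxE.
Qed.

End Homogeneous.

Section LinearSubstitution.
Context (F : comNzRingType) (n : nat).
Implicit Types (p q f : {mpoly F[n]}) (A B : 'M[F]_n) (x v : 'cV[F]_n).

Lemma comp_mpolyA p (S T : n.-tuple {mpoly F[n]}) :
  (p \mPo S) \mPo T = p \mPo [tuple tnth S l \mPo T | l < n].
Proof.
rewrite (comp_mpolyEX p S) (comp_mpolyEX p) (raddf_sum (comp_mpoly T)) /=.
apply: eq_bigr => m _; rewrite comp_mpolyZ; congr (_ *: _).
rewrite !comp_mpolyX (rmorph_prod (comp_mpoly T)) /=; apply: eq_bigr => l _.
by rewrite (rmorphXn (comp_mpoly T)) /= tnth_mktuple.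
Qed.

Lemma mderivXU i k : ('X_i : {mpoly F[n]})^`M(k) = ((i == k)%:R)%:MP.
Proof.
rewrite mderivX mnm1E; have [->|_] := eqVneq; last by rewrite scale0r.
by rewrite -{1}[U_(k)%MM]add0m addmK mpolyX0 scale1r.
Qed.

(** Chain rule: the polynomials satisfying it contain the variables and are
    closed under products and linear combinations. *)
Lemma mderiv_comp p (T : n.-tuple {mpoly F[n]}) k :
  (p \mPo T)^`M(k) = \sum_l (p^`M(l) \mPo T) * (tnth T l)^`M(k).
Proof.
pose chain q := (q \mPo T)^`M(k) = \sum_l (q^`M(l) \mPo T) * (tnth T l)^`M(k).
have chain1 : chain 1.
  rewrite /chain comp_mpoly1 mderivC big1 // => l _.
  by rewrite mderivC comp_mpoly0 mul0r.
have chainM q r : chain q -> chain r -> chain (q * r).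
  rewrite /chain => hq hr; rewrite (rmorphM (comp_mpoly T)) /= mderivM hq hr.
  rewrite mulr_suml mulr_sumr -big_split; apply: eq_bigr => l _ /=.
  rewrite mderivM comp_mpolyD !(rmorphM (comp_mpoly T)) /=; ring.
have chainX i : chain 'X_i.
  rewrite /chain comp_mpolyXU (bigD1 i) //= mderivXU eqxx.
  rewrite comp_mpolyC mul1r -tnth_nth big1 ?addr0 // => l li.
  by rewrite mderivXU eq_sym (negbTE li) comp_mpoly0 mul0r.
have chainXm m : chain 'X_[m].
  rewrite mpolyXE_id; apply: big_ind => // i _.
  by elim: (m i) => [|e IH]; rewrite ?expr0 // exprS; exact: chainM.
rewrite [in LHS](mpolyE p) (raddf_sum (comp_mpoly T)) (raddf_sum (mderiv k)) /=.
transitivity (\sum_(m <- msupp p) p@_m *: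
    \sum_l (('X_[m])^`M(l) \mPo T) * (tnth T l)^`M(k)).
  by apply: eq_bigr => m _; rewrite comp_mpolyZ mderivZ chainXm.
under [LHS]eq_bigr do rewrite scaler_sumr.
rewrite exchange_big /=; apply: eq_bigr => l _.
rewrite [in RHS](mpolyE p) (raddf_sum (mderiv l)) (raddf_sum (comp_mpoly T)) /=.
rewrite mulr_suml; apply: eq_bigr => m _.
by rewrite mderivZ comp_mpolyZ scalerAl.
Qed.

(** Row [l] of [A] is substituted for the variable of index [l], so that
    evaluating the result at [v] evaluates the original form at [A *m v]. *)
Definition lin_tuple A : n.-tuple {mpoly F[n]} :=
  [tuple \sum_k A l k *: 'X_k | l < n].

Definition lin_subst A f := f \mPo lin_tuple A.

Lemma lin_subst1 f : lin_subst 1%:M f = f.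
Proof.
rewrite -[RHS]comp_mpoly_id /lin_subst; congr comp_mpoly; apply: eq_from_tnth => l.
rewrite !tnth_mktuple (bigD1 l) //= mxE eqxx scale1r big1 ?addr0 // => k kl.
by rewrite mxE eq_sym (negbTE kl) scale0r.
Qed.

Lemma lin_substM A B f : lin_subst B (lin_subst A f) = lin_subst (A *m B) f.
Proof.
rewrite /lin_subst comp_mpolyA; congr comp_mpoly; apply: eq_from_tnth => l.
rewrite !tnth_mktuple (raddf_sum (comp_mpoly _)) /=.
under eq_bigr => k _.
  rewrite comp_mpolyZ comp_mpolyXU -tnth_nth tnth_mktuple scaler_sumr; over.
rewrite exchange_big /=; apply: eq_bigr => k _.
by rewrite mxE scaler_suml; apply: eq_bigr => r _; rewrite scalerA.
Qed.

Lemma lin_tuple_homog A l : tnth (lin_tuple A) l \is 1.-homog.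
Proof.
rewrite tnth_mktuple; apply: rpred_sum => k _; apply: rpredZ.
by rewrite dhomogX; apply/eqP; exact: mdeg1.
Qed.

Lemma lin_subst_homog A d f : f \is d.-homog -> lin_subst A f \is d.-homog.
Proof.
move=> /dhomogP hf; rewrite /lin_subst comp_mpolyEX big_seq; apply: rpred_sum => m /hf /= <-.
apply: rpredZ; rewrite comp_mpolyX mdegE.
elim/big_rec2: _ => [|l e q _ hq]; first exact: dhomog1.
apply: dhomogM => //; have := dhomogMn (m l) (lin_tuple_homog A l).
by rewrite mul1n.
Qed.

Lemma meval_lin_tuple A v l :
  (tnth (lin_tuple A) l).@[fun k => v k 0] = (A *m v) l 0.
Proof.
rewrite tnth_mktuple (raddf_sum (meval _)) /= mxE; apply: eq_bigr => k _.
by rewrite mevalZ mevalXU.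
Qed.

Lemma mderiv_lin_tuple A l k : (tnth (lin_tuple A) l)^`M(k) = (A l k)%:MP.
Proof.
rewrite tnth_mktuple (raddf_sum (mderiv k)) /= (bigD1 k) //= mderivZ.
rewrite mderivXU eqxx alg_mpolyC big1 ?addr0 // => r rk.
by rewrite mderivZ mderivXU (negbTE rk) scaler0.
Qed.

Lemma lin_subst_meval A f v :
  (lin_subst A f).@[fun k => v k 0] = f.@[fun k => (A *m v) k 0].
Proof.
rewrite comp_mpoly_meval; apply: meval_eq => l; exact: meval_lin_tuple.
Qed.

Lemma mderiv_lin_subst A f k :
  (lin_subst A f)^`M(k) = \sum_l A l k *: lin_subst A f^`M(l).
Proof.
rewrite mderiv_comp; apply: eq_bigr => l _.
by rewrite mderiv_lin_tuple mulrC mul_mpolyC.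
Qed.

Lemma grad_lin_subst A f v : grad (lin_subst A f) v = A^T *m grad f (A *m v).
Proof.
apply/colP => k; rewrite !mxE mderiv_lin_subst (raddf_sum (meval _)) /=.
by apply: eq_bigr => l _; rewrite mevalZ lin_subst_meval !mxE.
Qed.

Lemma hess_lin_subst A f v : hess (lin_subst A f) v = A^T *m hess f (A *m v) *m A.
Proof.
apply/matrixP => k r; rewrite !mxE mderiv_lin_subst (raddf_sum (mderiv r)) /=.
rewrite (raddf_sum (meval _)) /=.
under [RHS]eq_bigr do rewrite mxE mulr_suml.
rewrite exchange_big /=; apply: eq_bigr => l _.
rewrite mderivZ mderiv_lin_subst mevalZ (raddf_sum (meval _)) /= mulr_sumr.
apply: eq_bigr => s _; rewrite mevalZ lin_subst_meval !mxE; ring.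
Qed.

End LinearSubstitution.

(** * Normal form of a degenerate pair *)

Section Frame.
Context (F : comNzRingType) (n : nat).
Implicit Types (x w a : 'cV[F]_n) (i j k : 'I_n).

Definition ec i : 'cV[F]_n := delta_mx i 0.

Lemma ecE i k : ec i k 0 = (k == i)%:R.
Proof. by rewrite mxE eqxx andbT. Qed.

Lemma ec_mul i a : (ec i)^T *m a = (a i 0)%:M.
Proof. by rewrite trmx_delta -rowE; apply/matrixP => r s; rewrite !ord1 !mxE mulr1n. Qed.

Lemma shearK a i : a i 0 = 0 ->
  (1%:M + a *m (ec i)^T) *m (1%:M - a *m (ec i)^T) = 1%:M :> 'M_n.
Proof.
move=> ai; have nil : a *m (ec i)^T *m (a *m (ec i)^T) = 0.
  by rewrite mulmxA -(mulmxA a) ec_mul ai raddf0 mulmx0 mul0mx.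
by rewrite mulmxBr mulmx1 mulmxDl mul1mx nil addr0 addrK.
Qed.

Lemma shear_mul a b i : (1%:M + a *m (ec i)^T) *m b = b + b i 0 *: a.
Proof. by rewrite mulmxDl mul1mx -mulmxA ec_mul mul_mx_scalar. Qed.

Context (i j : 'I_n) (x w : 'cV[F]_n).

(** A unimodular matrix sending the coordinate vectors [ec i] and [ec j] to
    [x] and [w]: a product of two shears, so that its inverse is polynomial
    in [x] and [w] as well. *)
Definition frame : 'M[F]_n :=
  (1%:M + (x - ec i) *m (ec i)^T) *m (1%:M + (w - ec j) *m (ec j)^T).

Definition coframe : 'M[F]_n :=
  (1%:M - (w - ec j) *m (ec j)^T) *m (1%:M - (x - ec i) *m (ec i)^T).

Hypotheses (ij : i != j) (xi : x i 0 = 1) (wi : w i 0 = 0) (wj : w j 0 = 1).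

Lemma frameK : frame *m coframe = 1%:M.
Proof.
rewrite /frame /coframe -mulmxA [X in _ *m X]mulmxA shearK.
  by rewrite mul1mx shearK // !mxE xi !eqxx subrr.
by rewrite !mxE wj !eqxx subrr.
Qed.

Lemma frame_ec1 : frame *m ec i = x.
Proof.
rewrite /frame -mulmxA !shear_mul ecE eq_sym (negbTE ij) scale0r addr0.
by rewrite ecE eqxx scale1r addrC subrK.
Qed.

Lemma frame_ec2 : frame *m ec j = w.
Proof.
rewrite /frame -mulmxA !shear_mul ecE eqxx scale1r [ec j + _]addrC subrK.
by rewrite wi scale0r addr0.
Qed.

End Frame.

Section NormalForm.
Context (R : realType) (n e : nat).
Implicit Types (f : {mpoly R[n]}) (x u w : 'cV[R]_n).

Lemma cV_neq0P x : x != 0 -> exists i, x i 0 != 0.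
Proof.
move=> x0; apply/existsP; apply: contraT => /existsPn h.
by case/eqP: x0; apply/colP => i; rewrite mxE; have /negPn/eqP := h i.
Qed.

(** By homogeneity [x] may be rescaled to [y] with [y i = 1].  By the relation
    of Euler, [y] is an eigenvector of [hess f y], for [d - 1] times the
    multiplier; a multiple of [y] may therefore be subtracted from
    [u] to reach [w i = 0], at the price of changing the component of
    [hess f y *m w] along [y].  That component is recovered by pairing with
    [y].  Writing the multiplier as [c * dotv y y] keeps all the coefficients
    polynomial in [c], [y] and [w]. *)
Lemma degenerate_normal_form f x u lam mu :
  f \is e.+2.-homog -> x != 0 -> u != 0 -> dotv u x = 0 ->
  degenerate_at f x u lam mu ->
  exists (i j : 'I_n) (y w : 'cV[R]_n) (c : R),
    [/\ i != j, y i 0 = 1, w i 0 = 0, w j 0 = 1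
      & degenerate_at f y w (c * dotv y y) (c * e%:R * dotv y w)].
Proof.
move=> fh x0 u0 ux [gE hE].
have [i xi] := cV_neq0P x0.
have [a adef] : exists a, a = (x i 0)^-1 by eexists.
have a0 : a != 0 by rewrite adef invr_eq0.
have [y ydef] : exists y, y = a *: x by eexists.
have yi : y i 0 = 1 by rewrite ydef mxE adef mulVf.
have [w0 w0def] : exists w0, w0 = u - u i 0 *: y by eexists.
have w0n : w0 != 0.
  apply/eqP; rewrite w0def => /eqP; rewrite subr_eq0 => /eqP uE.
  move: ux; rewrite uE ydef scalerA dotvZl => /eqP; rewrite mulf_eq0.
  have /negbTE -> : dotv x x != 0 by apply: contra_neq x0 => /dotv_eq0.
  rewrite orbF => /eqP u'; case/eqP: u0.
  by rewrite uE ydef scalerA u' scale0r.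
have [j w0j] := cV_neq0P w0n.
have w0i : w0 i 0 = 0 by rewrite w0def !mxE yi mulr1 subrr.
have ij : i != j by apply: contra_neq w0j => <-.
have [b bdef] : exists b, b = (w0 j 0)^-1 by eexists.
have [w wdef] : exists w, w = b *: w0 by eexists.
have [L Ldef] : exists L, L = a ^+ e * lam by eexists.
have gy : grad f y = L *: y.
  rewrite ydef (grad_scale _ _ fh) gE !scalerA Ldef exprSr; congr (_ *: _); ring.
have hy : hess f y *m y = (e.+1%:R * L) *: y.
  by rewrite (hess_euler _ fh) gy scalerA.
have hu : hess f y *m u = L *: u + (a ^+ e * mu / a) *: y.
  rewrite ydef (hess_scale _ _ fh) -scalemxAl hE scalerDr !scalerA Ldef.
  by rewrite divfK.
(* [NE] below computes [N] from [c], [y] and [w] by pairing with [y]. *)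
have [N hw] : exists N, hess f y *m w = L *: w + N *: y.
  exists (b * (a ^+ e * mu / a + L * u i 0 - u i 0 * (e.+1%:R * L))).
  rewrite wdef w0def -scalemxAr mulmxBr -scalemxAr hu hy.
  by apply/colP => k; rewrite !mxE; ring.
have y0 : dotv y y != 0.
  apply/eqP => /dotv_eq0 y0; move/eqP: yi.
  by rewrite y0 mxE eq_sym oner_eq0.
have NE : N * dotv y y = e%:R * L * dotv y w.
  have := dotv_symmx y w (hess_sym f y).
  rewrite hw hy !dotvE_lin (dotvC w y) -natr1 => h.
  by rewrite -[LHS](addKr (L * dotv y w)) h; ring.
exists i, j, y, w, (L / dotv y y); split=> //.
- by rewrite wdef mxE w0i mulr0.
- by rewrite wdef mxE bdef mulVf.
- have -> : L / dotv y y * e%:R * dotv y w = N.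
    by apply: (mulIf y0); rewrite NE; field.
  by rewrite divfK.
Qed.

End NormalForm.

Section CoefficientVectors.
Context (R : realType) (n d : nat).
Implicit Types (f : {mpoly R[n]}) (v : 'rV[R]_(hdim n d)).

Definition nth_hmon (k : 'I_(hdim n d)) : 'X_{1..n} := val (enum_val k : hmon n d).

Lemma mdeg_nth_hmon k : mdeg (nth_hmon k) = d.
Proof. by have /eqP := valP (enum_val k : hmon n d). Qed.

Lemma nth_hmon_inj : injective nth_hmon.
Proof. by move=> k l /val_inj/val_inj/enum_val_inj. Qed.

Lemma nth_hmon_surj (m : 'X_{1..n}) : mdeg m = d -> exists k, nth_hmon k = m.
Proof.
move=> md; have mb : (mdeg m < d.+1)%N by rewrite md.
have md' : mdeg (BMultinom mb) == d by apply/eqP.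
exists (enum_rank (Sub (BMultinom mb) md' : hmon n d)).
by rewrite /nth_hmon enum_rankK SubK.
Qed.

Definition polyv v : {mpoly R[n]} := \sum_k v 0 k *: 'X_[nth_hmon k].

Lemma polyv_homog v : polyv v \is d.-homog.
Proof.
apply: rpred_sum => k _; apply: rpredZ; rewrite dhomogX; apply/eqP.
exact: mdeg_nth_hmon.
Qed.

Lemma mcoeff_polyv v m : (polyv v)@_m = \sum_k v 0 k * (nth_hmon k == m)%:R.
Proof.
by rewrite (raddf_sum (mcoeff m)) /=; apply: eq_bigr => k _; rewrite mcoeffZ mcoeffX.
Qed.

Lemma mcoeff_polyv_nth v k : (polyv v)@_(nth_hmon k) = v 0 k.
Proof.
rewrite mcoeff_polyv (bigD1 k) //= eqxx mulr1 big1 ?addr0 // => l lk.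
by rewrite (inj_eq nth_hmon_inj) (negbTE lk) mulr0.
Qed.

Lemma coefvE f k : coefv d f 0 k = f@_(nth_hmon k).
Proof. by rewrite mxE. Qed.

Lemma homog_eq f g : f \is d.-homog -> g \is d.-homog ->
  (forall k, f@_(nth_hmon k) = g@_(nth_hmon k)) -> f = g.
Proof.
move=> hf hg fg; apply/mpolyP => m; have [/nth_hmon_surj[k <-] //|md] := eqVneq (mdeg m) d.
by rewrite (dhomog_nemf_coeff hf md) (dhomog_nemf_coeff hg md).
Qed.

End CoefficientVectors.

(** * The degenerate forms as images of hyperplanes *)

Section Parametrisation.
Context (R : realType) (n e : nat) (i j : 'I_n).
Local Notation N := (hdim n e.+2).
Implicit Types (f p : {mpoly R[n]}) (v : 'rV[R]_N) (m : 'X_{1..n}).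

(** At the coordinate vector [ec i], the gradient of a form reads off its
    coefficients at the monomials [grad_mon k], and the Hessian applied to
    [ec j] those at the [hess_mon k].  The two families share only
    [grad_mon j = hess_mon i] when [i != j]. *)
Definition grad_mon (k : 'I_n) : 'X_{1..n} := (U_(i) *+ e.+1 + U_(k))%MM.
Definition hess_mon (k : 'I_n) : 'X_{1..n} := (U_(i) *+ e + U_(j) + U_(k))%MM.

Lemma mdeg_grad_mon k : mdeg (grad_mon k) = e.+2.
Proof. by rewrite /grad_mon mdegD mdegMn !mdeg1 mul1n addn1. Qed.

Lemma mdeg_hess_mon k : mdeg (hess_mon k) = e.+2.
Proof. by rewrite /hess_mon !mdegD mdegMn !mdeg1 mul1n !addn1. Qed.

Lemma grad_mon_inj : injective grad_mon.
Proof. by move=> k l /addmI /mnmP /(_ l); rewrite !mnm1E eqxx; case: eqP. Qed.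

Lemma hess_mon_inj : injective hess_mon.
Proof. by move=> k l /addmI /mnmP /(_ l); rewrite !mnm1E eqxx; case: eqP. Qed.

Lemma grad_mon_hess_mon k l : i != j -> l != i -> (grad_mon k == hess_mon l) = false.
Proof.
move=> ij li; apply/eqP => /mnmP /(_ i).
rewrite !mnmDE !mulmnE !mnm1E eqxx (negbTE li) (eq_sym j i) (negbTE ij).
by case: (k == i); lia.
Qed.

(** The factors that differentiation brings in front of these coefficients. *)
Definition grad_fac k := ((U_(i) *+ e.+1)%MM k).+1.
Definition hess_fac k := (((U_(i) *+ e + U_(j))%MM k).+1 * ((U_(i) *+ e)%MM j).+1)%N.

Lemma mcoeff_grad_mon f k : f \is e.+2.-homog ->
  f@_(grad_mon k) = (grad f (ec R i)) k 0 / (grad_fac k)%:R.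
Proof.
move=> hf; apply: (canRL (mulfK _)); first by rewrite pnatr_eq0.
rewrite mxE mulr_natr /grad_mon /grad_fac -mcoeff_mderiv.
rewrite -(meval_homog_delta i (mderiv_homog k hf)).
by apply: meval_eq => l; rewrite ecE.
Qed.

Lemma mcoeff_hess_mon f k : f \is e.+2.-homog ->
  f@_(hess_mon k) = (hess f (ec R i) *m ec R j) k 0 / (hess_fac k)%:R.
Proof.
move=> hf; apply: (canRL (mulfK _)); first by rewrite pnatr_eq0.
rewrite -colE !mxE mulr_natr /hess_mon /hess_fac mulrnA -!mcoeff_mderiv.
rewrite -(meval_homog_delta i (mderiv_homog j (mderiv_homog k hf))).
by apply: meval_eq => l; rewrite ecE.
Qed.

(** Decoding of a chart point [(x, w, c)] from the coefficients of a form [p].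
    In a degenerate form moved to standard position by [frame], the
    coefficients at [grad_mon k] and [hess_mon k] are determined by
    [(x, w, c)]; in [p] these places are free to carry that datum.  The place
    [hess_mon j] stays empty, since [w j = 1] is not stored. *)
Definition dec_x p : 'cV[R]_n := \col_k if k == i then 1 else p@_(grad_mon k).

Definition dec_w p : 'cV[R]_n :=
  \col_k if k == i then 0 else if k == j then 1 else p@_(hess_mon k).

Definition dec_c p : R := p@_(grad_mon i).

(** The gradient at [ec i] of the degenerate form in standard position. *)
Definition dec_grad p : 'cV[R]_n :=
  let x := dec_x p in let w := dec_w p in
  (frame i j x w)^T *m ((dec_c p * dotv x x) *: x).

(** Its Hessian at [ec i], applied to [ec j]. *)
Definition dec_hess p : 'cV[R]_n :=
  let x := dec_x p in let w := dec_w p in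
  (frame i j x w)^T *m
    ((dec_c p * dotv x x) *: w + (dec_c p * e%:R * dotv x w) *: x).

Definition dec_coef p m : R :=
  if [pick k | m == grad_mon k] is Some k then dec_grad p k 0 / (grad_fac k)%:R
  else if [pick k | m == hess_mon k] is Some k then dec_hess p k 0 / (hess_fac k)%:R
  else p@_m.

(** The form with the coefficients [dec_coef], moved back from standard
    position. *)
Definition degenerate_form p : {mpoly R[n]} :=
  lin_subst (coframe i j (dec_x p) (dec_w p))
    (polyv (\row_(k < N) dec_coef p (nth_hmon k))).

(** The preimage is the form moved to standard position, with its determined
    coefficients overwritten by the chart data; nothing is written at
    [hess_mon j], which gives the hyperplane. *)
Lemma degenerate_form_onto f (x w : 'cV[R]_n) (c : R) :
  f \is e.+2.-homog -> i != j -> x i 0 = 1 -> w i 0 = 0 -> w j 0 = 1 ->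
  degenerate_at f x w (c * dotv x x) (c * e%:R * dotv x w) ->
  exists2 v : 'rV[R]_N, (polyv v)@_(hess_mon j) = 0 & f = degenerate_form (polyv v).
Proof.
move=> fh ij xi wi wj [gE hE].
have [f' f'def] : exists f', f' = lin_subst (frame i j x w) f by eexists.
have f'h : f' \is e.+2.-homog by rewrite f'def lin_subst_homog.
(* The branch [k == i] stores [c] at [grad_mon i], as [x i = 1] is not stored. *)
pose enc m : R :=
  if [pick k | m == grad_mon k] is Some k then (if k == i then c else x k 0)
  else if [pick k | m == hess_mon k] is Some k then (if k == j then 0 else w k 0)
  else f'@_m.
have pick1 k : [pick l | grad_mon k == grad_mon l] = Some k.
  by case: pickP => [l /eqP/grad_mon_inj -> //|/(_ k)]; rewrite eqxx.
have pick2 k : [pick l | hess_mon k == hess_mon l] = Some k.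
  by case: pickP => [l /eqP/hess_mon_inj -> //|/(_ k)]; rewrite eqxx.
have pick12 k : k != i -> [pick l | hess_mon k == grad_mon l] = None.
  by move=> ki; case: pickP => // l; rewrite eq_sym grad_mon_hess_mon.
pose v : 'rV[R]_N := \row_k enc (nth_hmon k).
have [p pdef] : exists p, p = polyv v by eexists.
have pE m : mdeg m = e.+2 -> p@_m = enc m.
  by move=> /nth_hmon_surj[k <-]; rewrite pdef mcoeff_polyv_nth mxE.
have ji : j != i by rewrite eq_sym.
have decx : dec_x p = x.
  apply/colP => k; rewrite mxE; have [->//|ki] := eqVneq k i.
  by rewrite pE ?mdeg_grad_mon // /enc pick1 (negbTE ki).
have decw : dec_w p = w.
  apply/colP => k; rewrite mxE; have [->//|ki] := eqVneq k i.
  have [->//|kj] := eqVneq k j.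
  by rewrite pE ?mdeg_hess_mon // /enc pick12 // pick2 (negbTE kj).
have decc : dec_c p = c by rewrite /dec_c pE ?mdeg_grad_mon // /enc pick1 eqxx.
exists v; rewrite -pdef.
  by rewrite pE ?mdeg_hess_mon // /enc pick12 // pick2 eqxx.
have gF : grad f' (ec R i) = dec_grad p.
  by rewrite f'def grad_lin_subst frame_ec1 // gE /dec_grad decx decw decc.
have hF : hess f' (ec R i) *m ec R j = dec_hess p.
  rewrite f'def hess_lin_subst frame_ec1 // -[_ *m ec R j]mulmxA frame_ec2 // -mulmxA hE.
  by rewrite /dec_hess decx decw decc.
rewrite /degenerate_form decx decw.
rewrite -[LHS]lin_subst1 -(frameK xi wj) -lin_substM -f'def; congr lin_subst.
apply: (homog_eq f'h (polyv_homog _)) => k; rewrite mcoeff_polyv_nth mxE.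
rewrite /dec_coef; case: pickP => [l /eqP ->|no1].
  by rewrite mcoeff_grad_mon // gF.
case: pickP => [l /eqP ->|no2]; first by rewrite mcoeff_hess_mon // hF.
rewrite pE ?mdeg_nth_hmon // /enc; case: pickP => [l|_]; first by rewrite no1.
by case: pickP => [l|_ //]; rewrite no2.
Qed.

End Parametrisation.

Section LipschitzParametrisation.
Context (R : realType) (n N : nat).
Local Notation lip := (@cube_lipschitz R N).

Definition mx_lipschitz a b (A : 'rV[R]_N -> 'M[R]_(a, b)) : Prop :=
  forall r s, lip (fun t => A t r s).

Definition mpoly_lipschitz (p : 'rV[R]_N -> {mpoly R[n]}) : Prop :=
  forall m, lip (fun t => (p t)@_m).

Lemma lipschitz_eq (g h : 'rV[R]_N -> R) : g =1 h -> lip g -> lip h.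
Proof. by move=> /funext ->. Qed.

Lemma mx_lipschitz_cst a b (A : 'M[R]_(a, b)) : mx_lipschitz (fun=> A).
Proof. by move=> r s; exact: cube_lipschitz_cst. Qed.

Lemma mx_lipschitzD a b (A B : 'rV[R]_N -> 'M[R]_(a, b)) :
  mx_lipschitz A -> mx_lipschitz B -> mx_lipschitz (fun t => A t + B t).
Proof.
move=> lA lB r s.
by apply: (lipschitz_eq _ (cube_lipschitzD (lA r s) (lB r s))) => t; rewrite mxE.
Qed.

Lemma mx_lipschitzZ a b g (A : 'rV[R]_N -> 'M[R]_(a, b)) :
  lip g -> mx_lipschitz A -> mx_lipschitz (fun t => g t *: A t).
Proof.
move=> lg lA r s.
by apply: (lipschitz_eq _ (cube_lipschitzM lg (lA r s))) => t; rewrite mxE.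
Qed.

Lemma mx_lipschitzB a b (A B : 'rV[R]_N -> 'M[R]_(a, b)) :
  mx_lipschitz A -> mx_lipschitz B -> mx_lipschitz (fun t => A t - B t).
Proof.
move=> lA lB; apply: mx_lipschitzD => // r s.
apply: (lipschitz_eq _ (mx_lipschitzZ (cube_lipschitz_cst _ (-1)) lB r s)) => t.
by rewrite scaleN1r.
Qed.

Lemma mx_lipschitzM a b c (A : 'rV[R]_N -> 'M[R]_(a, b))
    (B : 'rV[R]_N -> 'M[R]_(b, c)) :
  mx_lipschitz A -> mx_lipschitz B -> mx_lipschitz (fun t => A t *m B t).
Proof.
move=> lA lB r s.
apply: (lipschitz_eq (g := fun t => \sum_k A t r k * B t k s)) => [t|].
  by rewrite mxE.
by apply: cube_lipschitz_sum => k _; apply: cube_lipschitzM; [exact: lA|exact: lB].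
Qed.

Lemma mx_lipschitz_tr a b (A : 'rV[R]_N -> 'M[R]_(a, b)) :
  mx_lipschitz A -> mx_lipschitz (fun t => (A t)^T).
Proof. by move=> lA r s; apply: (lipschitz_eq _ (lA s r)) => t; rewrite mxE. Qed.

Lemma dotv_lipschitz (u w : 'rV[R]_N -> 'cV[R]_n) :
  mx_lipschitz u -> mx_lipschitz w -> lip (fun t => dotv (u t) (w t)).
Proof. by move=> lu lw; exact: (mx_lipschitzM (mx_lipschitz_tr lu) lw). Qed.

Lemma frame_lipschitz i j (x w : 'rV[R]_N -> 'cV[R]_n) :
  mx_lipschitz x -> mx_lipschitz w ->
  mx_lipschitz (fun t => frame i j (x t) (w t)).
Proof.
move=> lx lw; apply: mx_lipschitzM; apply: mx_lipschitzD;
  try exact: mx_lipschitz_cst; apply: mx_lipschitzM;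
  try exact: mx_lipschitz_cst; apply: mx_lipschitzB => //;
  exact: mx_lipschitz_cst.
Qed.

Lemma coframe_lipschitz i j (x w : 'rV[R]_N -> 'cV[R]_n) :
  mx_lipschitz x -> mx_lipschitz w ->
  mx_lipschitz (fun t => coframe i j (x t) (w t)).
Proof.
move=> lx lw; apply: mx_lipschitzM; apply: mx_lipschitzB;
  try exact: mx_lipschitz_cst; apply: mx_lipschitzM;
  try exact: mx_lipschitz_cst; apply: mx_lipschitzB => //;
  exact: mx_lipschitz_cst.
Qed.

Lemma mpoly_lipschitz_cst p : mpoly_lipschitz (fun=> p).
Proof. by move=> m; exact: cube_lipschitz_cst. Qed.

Lemma mpoly_lipschitzM p q : mpoly_lipschitz p -> mpoly_lipschitz q ->
  mpoly_lipschitz (fun t => p t * q t).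
Proof.
move=> lp lq m; apply: (lipschitz_eq (fun t => esym (mcoeffM _ _ _))).
by apply: cube_lipschitz_sum => k _; apply: cube_lipschitzM; [exact: lp|exact: lq].
Qed.

Lemma mpoly_lipschitzX p k : mpoly_lipschitz p ->
  mpoly_lipschitz (fun t => p t ^+ k).
Proof.
move=> lp; elim: k => [|k IH]; first exact: mpoly_lipschitz_cst.
under eq_fun do rewrite exprS.
exact: mpoly_lipschitzM.
Qed.

Lemma mpoly_lipschitz_prod (I : Type) (r : seq I) p :
  (forall k, mpoly_lipschitz (p k)) ->
  mpoly_lipschitz (fun t => \prod_(k <- r) p k t).
Proof.
move=> lp; elim: r => [|k r IH].
  by under eq_fun do rewrite big_nil; exact: mpoly_lipschitz_cst.
by under eq_fun do rewrite big_cons; exact: mpoly_lipschitzM.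
Qed.

Lemma mpoly_lipschitz_sumZ (I : Type) (r : seq I) (g : I -> 'rV[R]_N -> R) p :
  (forall k, lip (g k)) -> (forall k, mpoly_lipschitz (p k)) ->
  mpoly_lipschitz (fun t => \sum_(k <- r) g k t *: p k t).
Proof.
move=> lg lp m.
apply: (lipschitz_eq (g := fun t => \sum_(k <- r) g k t * (p k t)@_m)) => [t|].
  by rewrite (raddf_sum (mcoeff m)) /=; apply: eq_bigr => k _; rewrite mcoeffZ.
by apply: cube_lipschitz_sum => k _; apply: cube_lipschitzM => //; exact: lp.
Qed.

(** Expanding the substitution monomial by monomial gives a sum whose index
    set, unlike the support, does not vary with the parameter. *)
Lemma lin_subst_polyv_lipschitz d (A : 'rV[R]_N -> 'M[R]_n)
    (v : 'rV[R]_N -> 'rV[R]_(hdim n d)) :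
  mx_lipschitz A -> mx_lipschitz v ->
  mpoly_lipschitz (fun t => lin_subst (A t) (polyv (v t))).
Proof.
move=> lA lv.
have -> : (fun t => lin_subst (A t) (polyv (v t))) = (fun t =>
    \sum_k v t 0 k *: \prod_l (\sum_s A t l s *: 'X_s) ^+ (nth_hmon k l)).
  apply/funext => t; rewrite /lin_subst /polyv (raddf_sum (comp_mpoly _)) /=.
  apply: eq_bigr => k _; rewrite comp_mpolyZ comp_mpolyX; congr (_ *: _).
  by apply: eq_bigr => l _; rewrite tnth_mktuple.
apply: mpoly_lipschitz_sumZ => k; first exact: lv.
apply: mpoly_lipschitz_prod => l; apply: mpoly_lipschitzX.
apply: mpoly_lipschitz_sumZ => s; first exact: lA.
exact: mpoly_lipschitz_cst.
Qed.

End LipschitzParametrisation.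

Section BadSet.
Context (R : realType) (n e : nat).
Local Notation N := (hdim n e.+2).

Lemma degenerate_form_lipschitz (i j : 'I_n) (k : 'I_N) :
  cube_lipschitz (fun v : 'rV[R]_N =>
    coefv e.+2 (degenerate_form e i j (polyv v)) 0 k).
Proof.
have lp m : cube_lipschitz (fun v : 'rV[R]_N => (polyv v)@_m).
  apply: (lipschitz_eq (fun v => esym (mcoeff_polyv v m))).
  apply: cube_lipschitz_sum => l _; apply: cube_lipschitzM.
    exact: cube_lipschitz_coord.
  exact: cube_lipschitz_cst.
have lx : mx_lipschitz (fun v : 'rV[R]_N => dec_x e i (polyv v)).
  move=> l s; under eq_fun do rewrite mxE.
  by case: eqP => _; [exact: cube_lipschitz_cst|exact: lp].
have lw : mx_lipschitz (fun v : 'rV[R]_N => dec_w e i j (polyv v)).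
  move=> l s; under eq_fun do rewrite mxE.
  case: eqP => _; first exact: cube_lipschitz_cst.
  by case: eqP => _; [exact: cube_lipschitz_cst|exact: lp].
have lc : cube_lipschitz (fun v : 'rV[R]_N => dec_c e i (polyv v)) by exact: lp.
have llam : cube_lipschitz (fun v : 'rV[R]_N =>
    dec_c e i (polyv v) * dotv (dec_x e i (polyv v)) (dec_x e i (polyv v))).
  by apply: cube_lipschitzM => //; exact: dotv_lipschitz.
have lfr := mx_lipschitz_tr (frame_lipschitz i j lx lw).
have lg : mx_lipschitz (fun v : 'rV[R]_N => dec_grad e i j (polyv v)).
  by apply: mx_lipschitzM => //; exact: mx_lipschitzZ.
have lh : mx_lipschitz (fun v : 'rV[R]_N => dec_hess e i j (polyv v)).
  apply: mx_lipschitzM => //; apply: mx_lipschitzD; apply: mx_lipschitzZ => //.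
  apply: cube_lipschitzM; last exact: dotv_lipschitz.
  by apply: cube_lipschitzM => //; exact: cube_lipschitz_cst.
under eq_fun do rewrite coefvE.
apply: lin_subst_polyv_lipschitz; first exact: coframe_lipschitz.
move=> r l; under eq_fun do rewrite mxE /dec_coef.
case: pickP => [s _|_].
  by apply: cube_lipschitzM; [exact: lg|exact: cube_lipschitz_cst].
case: pickP => [s _|_]; last exact: lp.
by apply: cube_lipschitzM; [exact: lh|exact: cube_lipschitz_cst].
Qed.

End BadSet.

Lemma hdim_gt0 n d : (0 < n)%N -> (0 < hdim n d)%N.
Proof.
move=> n0; have [|k _] := @nth_hmon_surj n d (U_(Ordinal n0) *+ d)%MM.
  by rewrite mdegMn mdeg1 mul1n.
exact: leq_ltn_trans (ltn_ord k).
Qed.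

Lemma homog0_polyC (R : nzRingType) n (p : {mpoly R[n]}) :
  p \is 0.-homog -> p = (p@_0%MM)%:MP.
Proof.
move=> ph; apply/mpolyP => m; rewrite mcoeffC.
have [->|m0] := eqVneq m 0%MM; first by rewrite mulr1.
by rewrite mulr0; apply: dhomog_nemf_coeff ph _; rewrite /= mdeg_eq0.
Qed.

(** In degree one the Hessian vanishes, so a degenerate form has multiplier
    zero, hence zero gradient. *)
Lemma degenerate_linear_eq0 (R : realType) n (f : {mpoly R[n]}) x u lam mu :
  f \is 1.-homog -> u != 0 -> dotv u x = 0 ->
  degenerate_at f x u lam mu -> f = 0.
Proof.
move=> fh u0 ux [gE hE].
have dE l : f^`M(l) = ((f^`M(l))@_0%MM)%:MP.
  exact: homog0_polyC (mderiv_homog l fh).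
have h0 : hess f x = 0.
  by apply/matrixP => k l; rewrite !mxE dE mderivC meval0.
have lam0 : lam = 0.
  have := congr1 (dotv u) hE.
  rewrite h0 mul0mx dotv0r !dotvE_lin ux mulr0 addr0.
  move=> /esym/eqP; rewrite mulf_eq0 => /orP[/eqP //|/eqP/dotv_eq0 u'].
  by rewrite u' eqxx in u0.
apply: (homog_eq fh (rpred0 _)) => k; rewrite mcoeff0.
have /eqP/mdeg1P[l /eqP ->] := mdeg_nth_hmon k.
have := congr1 (fun v : 'cV_n => v l 0) gE.
rewrite lam0 scale0r !mxE dE mevalC mcoeff_mderiv add0m => /eqP.
by rewrite mulrn_eq0 /= => /eqP.
Qed.

Theorem theorem3p4 (R : realType) (n d : nat) (hn : (0 < n)%N) (hd : (0 < d)%N) :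
  (forall (s : nat) (phis : 'I_s -> {mpoly int[hdim n d]}),
     elim_system R phis ->
     forall f : {mpoly R[n]}, f \is d.-homog -> phi phis f <> 0 ->
     forall x : 'cV[R]_n, SONC_point f x -> SOSC_point f x) /\
  generically d (fun f : {mpoly R[n]} =>
     forall x : 'cV[R]_n, SONC_point f x -> SOSC_point f x).
Proof.
split=> [s phis es f fh phi0 x|]; first exact: phi_neq0_SOSC es fh phi0.
suff [Z nZ ZP] : exists2 Z : set 'rV[R]_(hdim n d), lebesgue_null Z &
    forall f : {mpoly R[n]}, f \is d.-homog -> forall x u lam mu,
      x != 0 -> u != 0 -> dotv u x = 0 -> degenerate_at f x u lam mu ->
      Z (coefv d f).
  exists Z => // f fh nZf x; apply: SOSC_of_nondegenerate => u lam mu x1 u1 ux deg.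
  apply: nZf.
  exact: ZP fh _ _ _ _ (dotv1_neq0 x1) (dotv1_neq0 u1) ux deg.
have N0 := hdim_gt0 d hn.
case: d hd N0 => [//|[_ N0|e _ N0]].
  pose A (_ : unit) : set 'rV[R]_(hdim n 1) := [set 0].
  exists (\bigcup_c A c).
    by apply: lebesgue_null_bigcup => // c; exact: content_null_point.
  move=> f fh x u lam mu x0 u0 ux deg; exists tt => //.
  rewrite (degenerate_linear_eq0 fh u0 ux deg).
  by apply/rowP => k; rewrite !mxE mcoeff0.
pose Phi i j (v : 'rV[R]_(hdim n e.+2)) : 'rV[R]_(hdim n e.+2) :=
  coefv e.+2 (degenerate_form e i j (polyv v)).
(* Countably many pieces: the charts [(i, j)], and for each the integral
   radii of a cube. *)
pose A (c : 'I_n * 'I_n * nat) := [set Phi c.1.1 c.1.2 v | v in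
  [set v | in_cube c.2.+1%:R v /\ (polyv v)@_(hess_mon e c.1.1 c.1.2 c.1.2) = 0]].
exists (\bigcup_c A c).
  apply: lebesgue_null_bigcup => // -[[i j] M]; rewrite /A /=.
  have [k0 <-] := nth_hmon_surj (mdeg_hess_mon e i j j).
  under eq_set do rewrite mcoeff_polyv_nth.
  apply: content_null_hyperplane_image => // k.
  exact: degenerate_form_lipschitz.
move=> f fh x u lam mu x0 u0 ux deg.
have [i [j [y [w [c [ij yi wi wj deg']]]]]] :=
  degenerate_normal_form fh x0 u0 ux deg.
have [v v0 fE] := degenerate_form_onto fh ij yi wi wj deg'.
exists (i, j, Num.trunc (\sum_k `|v 0 k|)) => //; exists v; last by rewrite /Phi -fE.
split=> //= k; apply: le_trans (ltW (_ : \sum_l `|v 0 l| < _)).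
  by rewrite (bigD1 k) //= lerDl sumr_ge0.
by have /andP[] := truncn_itv (sumr_ge0 _ (fun l _ => normr_ge0 (v 0 l)) : 0 <= \sum_l `|v 0 l|).
Qed.
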